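(* Let $\mathfrak g$ be a $5$-dimensional real Lie algebra such that $[\mathfrak g,\mathfrak g]\ne\mathfrak g$ and admitting a contact Calabi–Yau structure. Then $\mathfrak g$ is isomorphic to the nilpotent Lie algebra $\mathfrak h_1$ with basis $X_1,\dots,X_5$ and nonzero brackets (up to skew-symmetry) $[X_1,X_4]=[X_2,X_3]=X_5$.
   Context: A contact Calabi–Yau structure on a $(2n+1)$-dimensional manifold $M$ is a triple $(\eta,J,\epsilon)$ where $(\eta,J)$ is a Sasakian structure and $\epsilon\in\Lambda^{n,0}_J(\ker\eta)$ is a nowhere vanishing basic form on $\ker\eta$ (i.e. $i_\xi\epsilon=0$, $\mathcal L_\xi\epsilon=0$ with $\xi$ the Reeb field) such that $d\epsilon=0$ and $\epsilon\wedge\bar\epsilon=(-1)^{n(n+1)/2}\,i^n(d\eta)^n$. Here $(\eta,J)$ Sasakian means: $\eta$ is a contact form with Reeb field $\xi$, $J$ is an endomorphism of $TM$ with $J^2=-\mathrm{Id}+\eta\otimes\xi$, $d\eta$ is $J$-invariant, $\frac12d\eta(\cdot,J\cdot)+\eta\otimes\eta$ is a Riemannian metric, and $N_J=-d\eta\otimes\xi$, where $N_J(X,Y)=[JX,JY]-J[X,JY]-J[JX,Y]+J^2[X,Y]$. A contact Calabi–Yau structure on a $5$-dimensional Lie algebra $\mathfrak g$ ($n=2$) is one whose tensors $\eta,J,\epsilon$ are defined on $\mathfrak g$ (equivalently, left-invariant on a Lie group with Lie algebra $\mathfrak g$), with $d$ the Chevalley–Eilenberg differential. *)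

(* Defs.v *)
From HB Require Import structures.
From mathcomp Require Import all_boot all_order all_algebra all_fingroup.
From mathcomp Require Import sesquilinear ring.
From mathcomp Require Import complex.
From mathcomp Require Import reals.

Set Implicit Arguments.
Unset Strict Implicit.
Unset Printing Implicit Defensive.

Import GRing.Theory Num.Theory.
Local Open Scope ring_scope.
Local Open Scope complex_scope.

Record lieAlgebra (R : realType) (V : vectType R) := LieAlgebra {
  lie_bracket :> {bilinear V -> V -> V};
  lie_alternating : forall x, lie_bracket x x = 0;
  lie_jacobi : forall x y z,
    lie_bracket x (lie_bracket y z) + lie_bracket y (lie_bracket z x)
    + lie_bracket z (lie_bracket x y) = 0
}.

Definition lie_isomorphic (R : realType) (V W : vectType R)
    (g : lieAlgebra V) (h : lieAlgebra W) : Prop :=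
  exists f : 'Hom(V, W), bijective f /\ forall x y, f (g x y) = h (f x) (f y).

(* [g, g]; by bilinearity the brackets of a basis suffice, see
   [derived_bracket] and [derived_min]. *)
Definition derived_algebra (R : realType) (V : vectType R) (g : lieAlgebra V)
    : {vspace V} :=
  <<[seq g x y | x <- vbasis {:V}, y <- vbasis {:V}]>>%VS.

Lemma derived_bracket (R : realType) (V : vectType R) (g : lieAlgebra V) x y :
  g x y \in derived_algebra g.
Proof.
rewrite (coord_vbasis (memvf x)) (coord_vbasis (memvf y)).
rewrite linear_sumlz; apply: memv_suml => i _.
rewrite linear_sumr; apply: memv_suml => j _.
rewrite linearZl_LR linearZr_LR; do 2!apply: memvZ; apply: memv_span.
by apply: allpairs_f; rewrite mem_nth // size_tuple.
Qed.

Lemma derived_min (R : realType) (V : vectType R) (g : lieAlgebra V)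
    (U : {vspace V}) :
  (forall x y, g x y \in U) -> (derived_algebra g <= U)%VS.
Proof. by move=> gU; apply/span_subvP => _ /allpairsP[p [_ _ ->]]. Qed.

Section Forms.
Variables (R : realType) (V : vectType R) (g : lieAlgebra V).

(* Left-invariant k-forms with values in A, as functions of k vectors. *)
Definition kform (A : Type) (k : nat) := k.-tuple V -> A.

Definition set_arg (k : nat) (v : k.-tuple V) (i : 'I_k) (x : V) : k.-tuple V :=
  [tuple if j == i then x else tnth v j | j < k].

(* Elements of Lambda^k(g^* ) (x) C: alternating, R-multilinear, C-valued. *)
Definition complex_form (k : nat) (w : kform R[i] k) : Prop :=
  (forall (v : k.-tuple V) (i : 'I_k) (a : R) (x y : V),
     w (set_arg v i (a *: x + y))
       = a%:C * w (set_arg v i x) + w (set_arg v i y)) /\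
  (forall (v : k.-tuple V) (i j : 'I_k),
     i != j -> tnth v i = tnth v j -> w v = 0).

Definition one_form (eta : {scalar V}) : kform R 1 := fun v => eta (tnth v 0).

(* Normalised so that (a /\ b)(x, y) = a x * b y - a y * b x on 1-forms. *)
Definition wedge (A : fieldType) (k l : nat) (a : kform A k) (b : kform A l)
    : kform A (k + l)%N :=
  fun v => (k`! * l`!)%:R^-1 *
    \sum_(s : 'S_(k + l)%N) (-1) ^+ s *
      a [tuple tnth v (s (lshift l i)) | i < k] *
      b [tuple tnth v (s (rshift k j)) | j < l].

Fixpoint wedge_pow (A : fieldType) (a : kform A 2) (n : nat) : kform A n.*2 :=
  match n return kform A n.*2 with
  | 0 => fun _ => 1
  | m.+1 => wedge a (@wedge_pow A a m)
  end.
Arguments wedge_pow {A} a n v.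

(* Chevalley-Eilenberg differential (trivial coefficients):
   dw(v_0, .., v_k) = sum_(p < q) (-1)^(p + q)
                        w([v_p, v_q], v_0, .. ^v_p .. ^v_q .., v_k),
   with q written as [lift p j], so that [lift p (lift j _)] enumerates in
   increasing order the indices different from p and q. *)
Definition ce_diff (A : zmodType) (k : nat) : kform A k -> kform A k.+1 :=
  match k return kform A k -> kform A k.+1 with
  | 0 => fun _ _ => 0
  | m.+1 => fun w v =>
      \sum_(p < m.+2) \sum_(j < m.+1 | (p < lift p j)%N)
        w [tuple of g (tnth v p) (tnth v (lift p j))
             :: [tuple tnth v (lift p (lift j l)) | l < m]]
        *~ ((-1) ^+ (p + lift p j)%N)
  end.

Definition interior (A : zmodType) (x : V) (k : nat)
    : kform A k -> kform A k.-1 :=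
  match k return kform A k -> kform A k.-1 with
  | 0 => fun _ _ => 0
  | m.+1 => fun w v => w [tuple of x :: v]
  end.

(* Lie derivative of a left-invariant form along a left-invariant field;
   the term x(w(v)) vanishes because w(v) is constant. *)
Definition lie_derivative (A : zmodType) (x : V) (k : nat) (w : kform A k)
    : kform A k :=
  fun v => - \sum_(i < k) w (set_arg v i (g x (tnth v i))).

Definition d_eta (eta : {scalar V}) : kform R 2 := ce_diff (one_form eta).

Definition contact_form (n : nat) (eta : {scalar V}) : Prop :=
  \dim {:V} = n.*2.+1 /\
  exists v, wedge (one_form eta) (wedge_pow (d_eta eta) n) v != 0.

Definition reeb_field (eta : {scalar V}) (xi : V) : Prop :=
  eta xi = 1 /\ forall v, interior xi (d_eta eta) v = 0.

Definition nijenhuis (J : 'End(V)) (x y : V) : V :=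
  g (J x) (J y) - J (g x (J y)) - J (g (J x) y) + J (J (g x y)).

Definition sasakian (n : nat) (eta : {scalar V}) (xi : V) (J : 'End(V))
    : Prop :=
  [/\ contact_form n eta /\ reeb_field eta xi,
      forall x, J (J x) = - x + eta x *: xi,
      forall x y, d_eta eta [tuple J x; J y] = d_eta eta [tuple x; y],
      exists m : {dot V for idfun}, forall x y,
        m x y = 2^-1 * d_eta eta [tuple x; J y] + eta x * eta y &
      forall x y, nijenhuis J x y = - (d_eta eta [tuple x; y] *: xi)].

(* w lies in Lambda^(k,0)_J(ker eta): w vanishes as soon as one argument is
   x + iJx, i.e. in the (-i)-eigenspace of J on ker eta (x) C. *)
Definition type_k0 (eta : {scalar V}) (J : 'End(V)) (k : nat)
    (w : kform R[i] k) : Prop :=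
  forall (v : k.-tuple V) (i : 'I_k), (forall j, eta (tnth v j) = 0) ->
    w v + 'i%C * w (set_arg v i (J (tnth v i))) = 0.

Definition contact_calabi_yau (n : nat) (eta : {scalar V}) (J : 'End(V))
    (eps : kform R[i] n) : Prop :=
  exists xi : V,
  [/\ sasakian n eta xi J,
      complex_form eps /\ type_k0 eta J eps,
      (exists v, eps v != 0) /\
        (forall v, interior xi eps v = 0) /\
        (forall v, lie_derivative xi eps v = 0),
      forall v, ce_diff eps v = 0 &
      forall v : (n + n)%N.-tuple V,
        wedge eps (fun u => (eps u)^*) v
          = (-1) ^+ (n * n.+1)%N./2 * 'i%C ^+ n
            * (wedge_pow (d_eta eta) n (tcast (addnn n) v))%:C].

End Forms.

Section H1.
Variable R : realType.
Implicit Types x y z : 'rV[R]_5.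

(* X_1, .., X_5 are delta_mx 0 0, .., delta_mx 0 4; see [h1_basis]. *)
Definition h1_bracket x y : 'rV[R]_5 :=
  (x 0 0 * y 0 3 - x 0 3 * y 0 0 + (x 0 1 * y 0 2 - x 0 2 * y 0 1))
    *: delta_mx 0 4.

Fact h1_linearl y : linear (h1_bracket^~ y).
Proof.
move=> a x x'; rewrite /h1_bracket scalerA -scalerDl !mxE.
by congr (_ *: _); ring.
Qed.

Fact h1_linearr x : linear (h1_bracket x).
Proof.
move=> a y y'; rewrite /h1_bracket scalerA -scalerDl !mxE.
by congr (_ *: _); ring.
Qed.

HB.instance Definition _ := bilinear_isBilinear.Build R 'rV[R]_5 'rV[R]_5
  'rV[R]_5 *:%R *:%R h1_bracket (pair h1_linearl h1_linearr).

Fact h1_alternating x : h1_bracket x x = 0.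
Proof.
by rewrite /h1_bracket mulrC subrr [_ * x 0 2]mulrC subrr addr0 scale0r.
Qed.

Fact h1_jacobi x y z :
  h1_bracket x (h1_bracket y z) + h1_bracket y (h1_bracket z x)
  + h1_bracket z (h1_bracket x y) = 0.
Proof.
have h1Z u v w : h1_bracket u (h1_bracket v w) = 0.
  by rewrite {1}/h1_bracket !mxE /= !(mulr0, subr0, addr0) scale0r.
by rewrite !h1Z !addr0.
Qed.

Definition h1 : lieAlgebra 'rV[R]_5 :=
  @LieAlgebra R 'rV[R]_5 h1_bracket h1_alternating h1_jacobi.

Lemma h1_basis (i j : 'I_5) : (i < j)%N ->
  h1 (delta_mx 0 i) (delta_mx 0 j)
    = if (i, j) \in [:: (0, 3); (1, 2)] then delta_mx 0 4 else 0.
Proof.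
rewrite /= /h1_bracket !mxE !inE.
case: i => [[|[|[|[|[|i]]]]] //= ?]; case: j => [[|[|[|[|[|j]]]]] //= ?] _;
by rewrite !(mulr0, mul0r, mulr1, subr0, sub0r, oppr0, addr0, add0r)
  ?scale0r ?scale1r.
Qed.

End H1.

(* Main.v *)
(* Sketch. Let omega = d eta, H = ker eta. Choose e0, e1 in H so that
   X_1 = e0, X_2 = e1, X_3 = J e1, X_4 = J e0, X_5 = -2 xi is a basis adapted
   to the transverse Kaehler structure. Up to a nonzero complex factor the
   closed (2,0)-form eps is then
   (X^1 + i X^4) /\ (X^2 + i X^3), so that d eta, Re eps and Im eps are (up to
   scale) the standard self-dual triple omega1, omega2, omega3 on H.
   Closedness says that the H-component B of the bracket on H is
   B(x, y) = A_x y - A_y x with A : H -> su(2) linear (the transverse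
   Levi-Civita connection). The Jacobi identity is the first Bianchi identity
   of A, up to terms in ad xi; the trace of it in which ad xi cancels is a
   positive definite quadratic form in A. Hence A = 0, so B = 0, and Jacobi
   then forces ad xi = 0: only [x, y] = - d eta(x, y) xi is left. *)
Require Import Defs.
From HB Require Import structures.
From mathcomp Require Import all_boot all_order all_algebra.
From mathcomp Require Import sesquilinear zify ring lra complex reals.

Set Implicit Arguments.
Unset Strict Implicit.
Unset Printing Implicit Defensive.

Import Order.TTheory GRing.Theory Num.Theory.
Local Open Scope ring_scope.
Local Open Scope complex_scope.

(** * Enumeration over five indices and over pairs of arguments *)

Lemma all_ord5 (P : 'I_5 -> Prop) :
  P 0 -> P 1 -> P 2 -> P 3 -> P 4 -> forall i, P i.
Proof.
move=> P0 P1 P2 P3 P4 [[|[|[|[|[|i]]]]] // lti].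
- by rewrite (_ : Ordinal lti = 0) //; apply: val_inj.
- by rewrite (_ : Ordinal lti = 1) //; apply: val_inj.
- by rewrite (_ : Ordinal lti = 2) //; apply: val_inj.
- by rewrite (_ : Ordinal lti = 3) //; apply: val_inj.
- by rewrite (_ : Ordinal lti = 4) //; apply: val_inj.
Qed.

Lemma sum_ord5 (M : nmodType) (F : 'I_5 -> M) :
  \sum_i F i = F 0 + F 1 + F 2 + F 3 + F 4.
Proof.
rewrite !big_ord_recr big_ord0 /= add0r.
by do !congr (_ + _); congr F; apply: val_inj.
Qed.

Lemma tuple2E (T : Type) (v : 2.-tuple T) : v = [tuple tnth v 0; tnth v 1].
Proof.
case/tupleP: v => x v; case/tupleP: v => y v.
by rewrite (tuple0 v); apply: val_inj.
Qed.

(** * The self-dual triple and the structure constants *)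

Section SelfDualForms.
Variable R : realFieldType.
Implicit Types u v : 'rV[R]_5.

Definition minor (i j : 'I_5) u v := u 0 i * v 0 j - u 0 j * v 0 i.

Definition omega1 u v := minor 0 3 u v + minor 1 2 u v.
(** [omega2] and [omega3] are the real and imaginary parts of (X^1 + i X^4) /\ (X^2 + i X^3), where
    [minor i j] is X^(i+1) /\ X^(j+1). *)
Definition omega2 u v := minor 0 1 u v + minor 2 3 u v.
Definition omega3 u v := minor 0 2 u v - minor 1 3 u v.

Lemma omega1_delta u : (omega1 u (delta_mx 0 0) = - u 0 3)
  * (omega1 u (delta_mx 0 1) = - u 0 2) * (omega1 u (delta_mx 0 2) = u 0 1)
  * (omega1 u (delta_mx 0 3) = u 0 0) * (omega1 u (delta_mx 0 4) = 0).
Proof. by rewrite /omega1 /minor !mxE /=; do !split; ring. Qed.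

Lemma omega2_delta u : (omega2 u (delta_mx 0 0) = - u 0 1)
  * (omega2 u (delta_mx 0 1) = u 0 0) * (omega2 u (delta_mx 0 2) = - u 0 3)
  * (omega2 u (delta_mx 0 3) = u 0 2) * (omega2 u (delta_mx 0 4) = 0).
Proof. by rewrite /omega2 /minor !mxE /=; do !split; ring. Qed.

Lemma omega3_delta u : (omega3 u (delta_mx 0 0) = - u 0 2)
  * (omega3 u (delta_mx 0 1) = u 0 3) * (omega3 u (delta_mx 0 2) = u 0 0)
  * (omega3 u (delta_mx 0 3) = - u 0 1) * (omega3 u (delta_mx 0 4) = 0).
Proof. by rewrite /omega3 /minor !mxE /=; do !split; ring. Qed.

Lemma omega1C u v : omega1 u v = - omega1 v u.
Proof. by rewrite /omega1 /minor; ring. Qed.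

Lemma scale_delta4 (c : R) u : u 0 0 = 0 -> u 0 1 = 0 -> u 0 2 = 0 ->
  u 0 3 = 0 -> u 0 4 = c -> u = c *: delta_mx 0 4.
Proof.
move=> u0 u1 u2 u3 u4; apply/rowP.
by apply: all_ord5; rewrite !mxE /= ?(mulr0, mulr1).
Qed.

(* A i j is the row of coordinates of [X_(i+1), X_(j+1)]. *)
Lemma structure_constants (A : 'I_5 -> 'I_5 -> 'rV[R]_5) :
  let dl := delta_mx 0 : 'I_5 -> 'rV[R]_5 in
  (forall i j, A i j = - A j i) ->
  (forall i j, A i j 0 4 = omega1 (dl i) (dl j)) ->
  (forall i j k : 'I_5, omega2 (A i j) (dl k) + omega2 (A j k) (dl i)
     + omega2 (A k i) (dl j) = 0) ->
  (forall i j k : 'I_5, omega3 (A i j) (dl k) + omega3 (A j k) (dl i)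
     + omega3 (A k i) (dl j) = 0) ->
  (forall i j k l, \sum_m (A j k 0 m * A i m 0 l + A k i 0 m * A j m 0 l
     + A i j 0 m * A k m 0 l) = 0) ->
  forall i j, A i j = omega1 (dl i) (dl j) *: dl 4.
Proof.
move=> dl AC A4 cl2 cl3 jac.
have ac i j k : A i j 0 k = - A j i 0 k by rewrite AC mxE.
have aa i k : A i i 0 k = 0 by have := ac i i k; lra.
(* Rewriting with [alt] leaves only constants [A i j] with i < j. *)
have alt := (ac 1 0, ac 2 0, ac 3 0, ac 2 1, ac 3 1, ac 3 2,
  ac 4 0, ac 4 1, ac 4 2, ac 4 3, aa).
have om : (omega1 (dl 0) (dl 1) = 0) * (omega1 (dl 0) (dl 2) = 0)
  * (omega1 (dl 0) (dl 3) = 1) * (omega1 (dl 1) (dl 2) = 1)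
  * (omega1 (dl 1) (dl 3) = 0) * (omega1 (dl 2) (dl 3) = 0).
  by rewrite !omega1_delta !mxE /= oppr0; do !split.
have a4 : (A 0 1 0 4 = 0) * (A 0 2 0 4 = 0) * (A 0 3 0 4 = 1)
  * (A 1 2 0 4 = 1) * (A 1 3 0 4 = 0) * (A 2 3 0 4 = 0) * (A 0 4 0 4 = 0)
  * (A 1 4 0 4 = 0) * (A 2 4 0 4 = 0) * (A 3 4 0 4 = 0).
  by rewrite !A4 !om !omega1_delta; do !split.
(* Closedness of omega1, which is the last coordinate of the Jacobi identity,
   and of omega2, omega3 leaves 12 free constants out of 24. *)
have [[A120 A121 A122 A123] [A130 A131 A132 A133] [A230 A231 A232 A233]] :
  [/\ [/\ A 1 2 0 0 = - 2 * A 0 3 0 0 + A 0 1 0 2 - A 0 2 0 1,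
          A 1 2 0 1 = - A 0 1 0 3 - A 0 2 0 0,
          A 1 2 0 2 = A 0 1 0 0 - A 0 2 0 3 &
          A 1 2 0 3 = A 0 1 0 1 + A 0 2 0 2],
      [/\ A 1 3 0 0 = A 0 1 0 3 + 2 * A 0 2 0 0 - A 0 3 0 1,
          A 1 3 0 1 = - A 0 3 0 0 + A 0 1 0 2,
          A 1 3 0 2 = - A 0 3 0 3 - A 0 1 0 1 &
          A 1 3 0 3 = A 0 3 0 2 + A 0 1 0 0] &
      [/\ A 2 3 0 0 = - 2 * A 0 1 0 0 + A 0 2 0 3 - A 0 3 0 2,
          A 2 3 0 1 = A 0 3 0 3 + A 0 2 0 2,
          A 2 3 0 2 = - A 0 3 0 0 - A 0 2 0 1 &
          A 2 3 0 3 = - A 0 3 0 1 + A 0 2 0 0]].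
  move: (cl2 0 1 2) (cl2 0 1 3) (cl2 0 2 3) (cl2 1 2 3).
  rewrite !omega2_delta !alt => ? ? ? ?.
  move: (cl3 0 1 2) (cl3 0 1 3) (cl3 0 2 3) (cl3 1 2 3).
  rewrite !omega3_delta !alt => ? ? ? ?.
  move: (jac 0 1 2 4) (jac 0 1 3 4) (jac 0 2 3 4) (jac 1 2 3 4).
  rewrite !sum_ord5 !alt !a4 => ? ? ? ?.
  by do !split; lra.
(* These four entries of ad X_5 are the only ones in the Jacobi components used below; closedness
   with X_5 as one argument identifies them in pairs. *)
have [A043 A142] : A 0 4 0 3 = A 2 4 0 1 /\ A 1 4 0 2 = A 3 4 0 0.
  by move: (cl2 4 0 2) (cl2 4 3 1); rewrite !omega2_delta !alt => ? ?; split; lra.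
(* The trace of the Jacobi identity in which ad X_5 cancels. *)
have : (A 0 3 0 3) ^+ 2 + (A 0 1 0 1) ^+ 2 + (A 0 2 0 2) ^+ 2
    + (A 0 3 0 0 - A 0 1 0 2) ^+ 2 + (A 0 3 0 0 + A 0 2 0 1) ^+ 2
    + (A 0 3 0 0) ^+ 2
    + (A 0 1 0 0 + A 0 3 0 2) ^+ 2 + (A 0 1 0 0 - A 0 2 0 3) ^+ 2
    + (A 0 1 0 0) ^+ 2
    + (A 0 2 0 0 - A 0 3 0 1) ^+ 2 + (A 0 2 0 0 + A 0 1 0 3) ^+ 2
    + (A 0 2 0 0) ^+ 2 = 0.
  move: (jac 0 1 2 3) (jac 0 1 3 2) (jac 0 2 3 1) (jac 1 2 3 0).
  rewrite !sum_ord5 !alt !a4 A120 A121 A122 A123 A130 A131 A132 A133.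
  by rewrite A230 A231 A232 A233; lra.
(* Each of the twelve squares vanishes, and together they kill the twelve free constants: the
   horizontal parts of [A 0 1], [A 0 2] and [A 0 3]. *)
move=> /eqP; rewrite !paddr_eq0 ?addr_ge0 ?sqr_ge0 // !sqrf_eq0.
do 11!case/andP; do 12!move=> /eqP ?.
pose P i j := A i j = omega1 (dl i) (dl j) *: dl 4.
have PC i j : P i j -> P j i.
  by rewrite /P => Aij; rewrite AC Aij -scaleNr -omega1C.
have P01 : P 0 1 by apply: scale_delta4 => //; lra.
have P02 : P 0 2 by apply: scale_delta4 => //; lra.
have P03 : P 0 3 by apply: scale_delta4 => //; lra.
have P12 : P 1 2 by apply: scale_delta4 => //; lra.
have P13 : P 1 3 by apply: scale_delta4 => //; lra.
have P23 : P 2 3 by apply: scale_delta4 => //; lra.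
(* Here Jacobi reduces to its single term [A i 4]. Each index below 4 is completed by the pair of
   the [omega1] summand that does not contain it. *)
have Jac4 i j k : A j k = dl 4 -> A k i = 0 -> A i j = 0 -> A i 4 = 0.
  move=> Ajk Aki Aij; apply/rowP => l; rewrite mxE -(jac i j k l) Ajk Aki Aij.
  by rewrite sum_ord5 !mxE /=; ring.
have Ai4 : forall i, A i 4 = 0.
  move: P01 P02 P03 P12 P13 P23; rewrite /P !om !scale0r !scale1r.
  move=> Z01 Z02 Z03 Z12 Z13 Z23; apply: all_ord5.
  - by apply: (Jac4 _ 1 2) => //; rewrite AC Z02 oppr0.
  - by apply: (Jac4 _ 0 3) => //; rewrite AC ?Z01 ?Z13 oppr0.
  - by apply: (Jac4 _ 0 3) => //; rewrite AC ?Z02 ?Z23 oppr0.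
  - by apply: (Jac4 _ 1 2) => //; rewrite AC ?Z13 ?Z23 oppr0.
  - by apply/rowP => k; rewrite mxE aa.
have P4 i : P i 4 by rewrite /P omega1_delta scale0r Ai4.
have Pii i : P i i.
  by apply/rowP => k; rewrite aa !mxE /omega1 /minor; ring.
by apply: all_ord5; apply: all_ord5;
  do ?[exact: Pii | exact: P4 | assumption | apply: PC].
Qed.

End SelfDualForms.

(** * Adapted frames *)

Section Frames.
Variables (R : realType) (V : vectType R) (g : lieAlgebra V).
Variables (f : {linear V -> 'rV[R]_5}) (e : 'I_5 -> V).

Lemma lieC x y : g x y = - g y x.
Proof.
have := lie_alternating g (x + y).
rewrite linearDr !linearDl /= !lie_alternating add0r addr0 => /eqP.
by rewrite addrC addr_eq0 => /eqP.
Qed.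

(** The map [f] is onto, as it reaches the standard basis, hence injective by equality of
    dimensions; both sides have the same image under [f]. *)
Lemma frame_expansion x :
  \dim {:V} = 5%N -> (forall i, f (e i) = delta_mx 0 i) ->
  x = \sum_i f x 0 i *: e i.
Proof.
move=> dimV fe.
have fsum (u : 'rV[R]_5) : f (\sum_i u 0 i *: e i) = u.
  rewrite linear_sum [RHS]row_sum_delta; apply: eq_bigr => i _.
  by rewrite linearZ fe.
have ff : linfun f =1 f by move=> z; rewrite lfunE.
have kerf : lker (linfun f) == 0%VS.
  have imf : limg (linfun f) = fullv.
    by apply/vspaceP => u; rewrite memvf -[u]fsum -ff memv_img ?memvf.
  have := limg_ker_dim (linfun f) fullv.
  rewrite imf dimV dimvf /dim /= mul1n capfv => /eqP.
  by rewrite -[X in _ == X]add0n eqn_add2r dimv_eq0.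
by apply: (lker0P kerf); rewrite !ff fsum.
Qed.

(** The morphism [phi] lets one expansion serve both the real form [eta (g x y)] and the complex
    form [eps]. *)
Lemma alternating_expansion (K : comNzRingType) (phi : {rmorphism R -> K})
    (B : V -> V -> K) x y :
  \dim {:V} = 5%N -> (forall i, f (e i) = delta_mx 0 i) ->
  (forall a u v z, B (a *: u + v) z = phi a * B u z + B v z) ->
  (forall u v, B u v = - B v u) -> (forall u, B u u = 0) ->
  let m i j := phi (minor i j (f x) (f y)) * B (e i) (e j) in
  B x y = m 0 1 + m 0 2 + m 0 3 + m 0 4 + m 1 2 + m 1 3 + m 1 4
    + m 2 3 + m 2 4 + m 3 4.
Proof.
move=> dimV fe linB BC B_alt /=.
have B0 z : B 0 z = 0.
  have := linB (-1) 0 0 z.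
  by rewrite scaleN1r oppr0 addr0 rmorphN1 mulN1r addNr.
have Bl u z : B u z = \sum_i phi (f u 0 i) * B (e i) z.
  rewrite {1}(frame_expansion u dimV fe).
  elim/big_rec2: _ => [|i b v _ <-]; first exact: B0.
  exact: linB.
rewrite Bl; under eq_bigr do rewrite BC Bl.
rewrite !sum_ord5 !B_alt (BC (e 1) (e 0)) (BC (e 2) (e 0)) (BC (e 3) (e 0)).
rewrite (BC (e 4) (e 0)) (BC (e 2) (e 1)) (BC (e 3) (e 1)) (BC (e 4) (e 1)).
rewrite (BC (e 3) (e 2)) (BC (e 4) (e 2)) (BC (e 4) (e 3)).
by rewrite /minor !rmorphB !rmorphM /=; ring.
Qed.

(** The hypotheses on [f] say that dX^5 = - [omega1] and that [omega2] and [omega3] are closed. *)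
Lemma heisenberg_of_frame :
  \dim {:V} = 5%N ->
  (forall i, f (e i) = delta_mx 0 i) ->
  (forall x y, f (g x y) 0 4 = omega1 (f x) (f y)) ->
  (forall x y z, omega2 (f (g x y)) (f z) + omega2 (f (g y z)) (f x)
     + omega2 (f (g z x)) (f y) = 0) ->
  (forall x y z, omega3 (f (g x y)) (f z) + omega3 (f (g y z)) (f x)
     + omega3 (f (g z x)) (f y) = 0) ->
  lie_isomorphic g (h1 R).
Proof.
move=> dimV fe f4 cl2 cl3.
have esum x := frame_expansion x dimV fe.
have ff : linfun f =1 f by move=> x; rewrite lfunE.
pose A i j := f (g (e i) (e j)).
have AE : forall i j,
    A i j = omega1 (delta_mx 0 i) (delta_mx 0 j) *: delta_mx 0 4.
  apply: structure_constants => [i j|i j|i j k|i j k|i j k l].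
  - by rewrite /A lieC linearN.
  - by rewrite /A f4 !fe.
  - by have := cl2 (e i) (e j) (e k); rewrite !fe.
  - by have := cl3 (e i) (e j) (e k); rewrite !fe.
  have gsum h x : f (g (e h) x) 0 l = \sum_m f x 0 m * A h m 0 l.
    rewrite {1}(esum x) linear_sumr linear_sum summxE; apply: eq_bigr => m _.
    by rewrite linearZr_LR linearZ mxE.
  have /(congr1 (fun x => f x 0 l)) := lie_jacobi g (e i) (e j) (e k).
  by rewrite !linearD linear0 !mxE !gsum -!big_split.
exists (linfun f); split.
  exists (fun u : 'rV_5 => \sum_i u 0 i *: e i) => [x|u].
    by rewrite ff -esum.
  rewrite ff linear_sum [RHS]row_sum_delta; apply: eq_bigr => i _.
  by rewrite linearZ fe.
move=> x y; rewrite !ff {1}(esum x) {1}(esum y).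
rewrite [in RHS](row_sum_delta (f x)) [in RHS](row_sum_delta (f y)).
rewrite !linear_sumlz linear_sum; apply: eq_bigr => i _.
rewrite !linear_sumr linear_sum; apply: eq_bigr => j _.
(* The value given by [AE] is, by conversion, the bracket of [h1] on basis vectors. *)
by rewrite !linearZl_LR !linearZr_LR !(linearZ_LR f) -/(A i j) AE.
Qed.

End Frames.

(** * Sasakian structures *)

Section Sasakian.
Variables (R : realType) (V : vectType R) (g : lieAlgebra V).

Lemma d_etaE (eta : {scalar V}) x y :
  d_eta g eta [tuple x; y] = - eta (g x y).
Proof.
rewrite /d_eta /ce_diff /= big_mkcond /= !big_ord_recl !big_ord0 /=.
by rewrite !big_mkcond !big_ord_recl !big_ord0 /= !addr0 mulrN1z.
Qed.

Lemma ce_diff2E (w : kform V R[i] 2) x y z :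
  ce_diff g w [tuple x; y; z]
    = - w [tuple g x y; z] + w [tuple g x z; y] - w [tuple g y z; x].
Proof.
have two (a : V) (F : 'I_1 -> V) :
    [tuple of a :: [tuple F l | l < 1]] = [tuple a; F ord0].
  by apply: val_inj; rewrite /= enum_ordSl enum_ord0.
rewrite /ce_diff /= !big_ord_recl big_ord0 !big_mkcond /=.
rewrite !big_ord_recl !big_ord0 /= !two.
rewrite ?addr0 ?add0r ?subr0 /= /bump /=.
rewrite [X in _ + (_ + X)]big_mkcond !big_ord_recl big_ord0 /= !addr0.
transitivity (w [tuple g x y; z] *~ (-1) + w [tuple g x z; y] *~ 1
    + w [tuple g y z; x] *~ (-1)); first by [].
by rewrite !mulrN1z mulr1z.
Qed.

Lemma set_arg0 (x y z : V) : set_arg [tuple x; y] 0 z = [tuple z; y].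
Proof. by apply: val_inj; rewrite /= !enum_ordSl enum_ord0. Qed.

Lemma set_arg1 (x y z : V) : set_arg [tuple x; y] 1 z = [tuple x; z].
Proof. by apply: val_inj; rewrite /= !enum_ordSl enum_ord0. Qed.

Lemma complex_form2 (w : kform V R[i] 2) : complex_form w ->
  [/\ forall a x x' y, w [tuple a *: x + x'; y]
        = a%:C * w [tuple x; y] + w [tuple x'; y],
      forall x y, w [tuple x; y] = - w [tuple y; x] &
      forall x, w [tuple x; x] = 0].
Proof.
move=> [lin alt].
have linl a x x' y :
    w [tuple a *: x + x'; y] = a%:C * w [tuple x; y] + w [tuple x'; y].
  by have := lin [tuple x; y] 0 a x x'; rewrite !set_arg0.
have linr a x x' y :
    w [tuple y; a *: x + x'] = a%:C * w [tuple y; x] + w [tuple y; x'].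
  by have := lin [tuple y; x] 1 a x x'; rewrite !set_arg1.
have diag x : w [tuple x; x] = 0 by apply: (alt _ 0 1).
split=> // x y; have := diag (1 *: x + y).
rewrite linl !linr !diag mulr0 addr0 add0r !mul1r => /eqP.
by rewrite addr_eq0 => /eqP.
Qed.

Lemma ce_closed2 (w : kform V R[i] 2) :
  complex_form w -> (forall v, ce_diff g w v = 0) ->
  forall x y z,
    w [tuple g x y; z] + w [tuple g y z; x] + w [tuple g z x; y] = 0.
Proof.
move=> /complex_form2[lin _ _] cl x y z.
have w0 v : w [tuple 0; v] = 0.
  have /eqP := lin 1 0 0 v.
  by rewrite scaler0 addr0 mul1r -subr_eq subrr eq_sym => /eqP.
have wN u v : w [tuple - u; v] = - w [tuple u; v].
  by rewrite -[- u]addr0 -scaleN1r lin rmorphN1 mulN1r w0 addr0.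
have := cl [tuple x; y; z]; rewrite ce_diff2E (lieC g x z) wN => cl_xyz.
by apply: oppr_inj; rewrite oppr0 -cl_xyz; ring.
Qed.

Lemma sasakian_basic n (eta : {scalar V}) xi J : sasakian g n eta xi J ->
  [/\ eta xi = 1, forall x, eta (g xi x) = 0 & forall x, eta (J x) = 0] /\
  [/\ forall x, J (J x) = - x + eta x *: xi,
      forall x y, eta (g (J x) (J y)) = eta (g x y) &
      forall x, x != 0 -> eta x = 0 -> eta (g x (J x)) < 0].
Proof.
move=> [[_ [eta1 reeb]] JJ Jw [m mE] _].
have xi0 : xi != 0.
  apply/eqP => xi0; move: eta1; rewrite xi0 linear0 => /eqP.
  by rewrite eq_sym oner_eq0.
have JJxi : J (J xi) = 0 by rewrite JJ eta1 scale1r addNr.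
(* Computing J^3 xi in two ways gives J xi = a xi; then J^2 xi = 0 forces a^2 = 0. *)
have Jxi : J xi = 0.
  have : J xi = eta (J xi) *: xi.
    by apply/eqP; rewrite eq_sym -subr_eq0 addrC -JJ JJxi linear0.
  move: (eta (J xi)) => a Jxi; move: JJxi.
  rewrite Jxi linearZ /= Jxi scalerA => /eqP.
  rewrite scaler_eq0 (negPf xi0) orbF mulf_eq0 orbb => /eqP->.
  by rewrite scale0r.
split; split=> //.
- move=> x; have := reeb [tuple x]; rewrite /interior /=.
  rewrite (_ : [tuple of _ :: _] = [tuple xi; x]); last exact: val_inj.
  by rewrite d_etaE => /eqP; rewrite oppr_eq0 => /eqP.
(* Compare J applied to J^2 x with J^2 applied to J x: they differ by [eta (J x) *: xi]. *)
- move=> x; have /eqP := congr1 J (JJ x).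
  rewrite JJ linearD linearN linearZ /= Jxi scaler0 addr0 addrC -subr_eq0 addrK.
  by rewrite scaler_eq0 (negPf xi0) orbF => /eqP.
- by move=> x y; have := Jw x y; rewrite !d_etaE => /oppr_inj.
- move=> x x0 etax; have := neq0_dnorm_gt0 (s := m) x x0.
  by rewrite mE d_etaE etax; lra.
Qed.

Lemma dim_cap_lker (U : {vspace V}) (h : 'Hom(V, R^o)) :
  (\dim U <= (\dim (U :&: lker h)).+1)%N.
Proof.
rewrite -(limg_ker_dim h U) -addn1 leq_add2l.
by rewrite (leq_trans (dimvS (subvf _))) // dimvf.
Qed.

(** On ker eta the Sasakian metric gives x the squared length - eta [x, J x] / 2, so the value -2
    means a unit vector. *)
Lemma normalize_bracket (eta : {scalar V}) (J : 'End(V)) x :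
  eta (g x (J x)) < 0 -> exists a : R, eta (g (a *: x) (J (a *: x))) = -2.
Proof.
move=> lt0.
have h0 : 0 <= 2 / - eta (g x (J x)) by rewrite divr_ge0 // oppr_ge0 ltW.
exists (Num.sqrt (2 / - eta (g x (J x)))).
rewrite linearZ linearZl_LR linearZr_LR !linearZ /= mulrA -expr2 sqr_sqrtr //.
by field; rewrite lt_eqF.
Qed.

(** Unitary Gram-Schmidt on ker eta: the last two equations say that [e1] is orthogonal to J [e0]
    and to [e0]. They cut a space of dimension at least 4 by two functionals, so a nonzero choice
    remains. *)
Lemma hermitian_frame n (eta : {scalar V}) xi J :
  \dim {:V} = 5%N -> sasakian g n eta xi J ->
  exists e0 e1, [/\ eta e0 = 0, eta e1 = 0, eta (g e0 (J e0)) = -2,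
    eta (g e1 (J e1)) = -2 & eta (g e1 e0) = 0 /\ eta (g e1 (J e0)) = 0].
Proof.
move=> dimV /sasakian_basic[[_ _ _] [_ _ pos]].
have unit_in (U : {vspace V}) :
    (0 < \dim U)%N -> (forall x, x \in U -> eta x = 0) ->
    exists2 x, x \in U & eta (g x (J x)) = -2.
  rewrite lt0n dimv_eq0 -vpick0 => U0 etaU; have xU := memv_pick U.
  have [a ax] := normalize_bracket (pos _ U0 (etaU _ xU)).
  by exists (a *: vpick U) => //; apply: memvZ.
pose H := (fullv :&: lker (linfun (eta : V -> R^o)))%VS.
have inH x : x \in H -> eta x = 0.
  by rewrite memv_cap => /andP[_]; rewrite memv_ker lfunE => /eqP.
have dimH : (4 <= \dim H)%N by rewrite -ltnS -dimV; exact: dim_cap_lker.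
have [e0 e0H n0] := unit_in H (ltnW (ltnW (ltnW dimH))) inH.
pose phi y := linfun (eta \o applyr g y : V -> R^o).
pose W := (H :&: lker (phi e0) :&: lker (phi (J e0)))%VS.
have dimW : (0 < \dim W)%N.
  have := dim_cap_lker H (phi e0).
  have := dim_cap_lker (H :&: lker (phi e0)) (phi (J e0)).
  by rewrite -/W; lia.
have inW x : x \in W ->
    [/\ eta x = 0, eta (g x e0) = 0 & eta (g x (J e0)) = 0].
  rewrite memv_cap => /andP[]; rewrite memv_cap => /andP[/inH-> ].
  by rewrite !memv_ker !lfunE /= => /eqP ? /eqP ?.
have etaW x : x \in W -> eta x = 0 by case/inW.
have [e1 e1W n1] := unit_in W dimW etaW.
have [? ? ?] := inW _ e1W.
by exists e0, e1; split=> //; exact: inH.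
Qed.

End Sasakian.

(** * Adapted coframe of a contact Calabi-Yau structure and its (2,0)-form *)

Theorem proposition4p5 (R : realType) (V : vectType R) (g : lieAlgebra V)
    (dim_g : \dim {:V} = 5%N)
    (not_perfect : derived_algebra g <> fullv)
    (cCY : exists (eta : {scalar V}) (J : 'End(V)) (eps : kform V R[i] 2),
       contact_calabi_yau g eta J eps) :
  lie_isomorphic g (h1 R).
Proof.
case: cCY => eta [J [eps [xi [sas [cf t20] [[v epsv] [epsxi _]] cl _]]]].
have [[eta1 wxi etaJ] [JJ Jw _]] := sasakian_basic sas.
have [a [b [etaa etab wad wbc [wba wbd]]]] := hermitian_frame dim_g sas.
have [epsl epsC eps0] := complex_form2 cf.
have wC x y : eta (g x y) = - eta (g y x) by rewrite lieC linearN.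
have w0 x : eta (g x x) = 0 by rewrite lie_alternating linear0.
have epsX y : eps [tuple xi; y] = 0.
  by rewrite -(epsxi [tuple y]) /interior /=; congr eps; apply: val_inj.
have iC : ('i%C : R[i]) * 'i%C = -1 by rewrite -expr2 sqr_i.
have epsJ x y : eta x = 0 -> eta y = 0 ->
    eps [tuple J x; y] = 'i%C * eps [tuple x; y].
  move=> x0 y0.
  have type20 : eps [tuple x; y] + 'i%C * eps [tuple J x; y] = 0.
    have := t20 [tuple x; y] 0; rewrite set_arg0.
    by apply=> -[[|[|j]]] // ltj; rewrite (tnth_nth 0).
  have := congr1 (fun z => 'i%C * z) type20.
  rewrite /= mulr0 mulrDr mulrA iC mulN1r => /eqP.
  by rewrite subr_eq0 => /eqP.
set c := J b in wbc; set d := J a in wad wbd.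
have Jc : J c = - b by rewrite JJ etab scale0r addr0.
have wac : eta (g a c) = 0.
  by rewrite -Jw Jc linearNr linearN /= wC wbd oppr0 oppr0.
have wcd : eta (g c d) = 0 by rewrite Jw.
have [etac etad] : eta c = 0 /\ eta d = 0 by rewrite !etaJ.
pose e (i : 'I_5) := nth 0 [:: a; b; c; d; - 2 *: xi] i.
(* The coframe dual to [e], read off from eta: as eta [a, d] = eta [b, c] = -2, pairing with the
   conjugate vector isolates each coordinate. The choice X_5 = -2 xi gives [X_1, X_4] fifth
   coordinate 1. *)
pose f0 (x : V) : 'rV[R]_5 := \row_i nth 0
  [:: - 2^-1 * eta (g x d); - 2^-1 * eta (g x c); 2^-1 * eta (g x b);
      2^-1 * eta (g x a); - 2^-1 * eta x] i.
have f0lin : linear f0.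
  move=> k x y; apply/rowP; apply: all_ord5;
  by rewrite !mxE /= ?linearDl ?linearZl_LR !linearD !linearZ /=; ring.
pose f : {linear V -> 'rV[R]_5} :=
  HB.pack f0 (GRing.isLinear.Build R V 'rV[R]_5 _ f0 f0lin).
have fe : forall i, f (e i) = delta_mx 0 i.
  have wtab := (w0, wad, wbc, wba, wbd, wac, wcd, wC a b, wC c a, wC d a,
    wC c b, wC d b, wC d c, wxi, etaa, etab, etac, etad, eta1).
  by apply: all_ord5; apply/rowP; apply: all_ord5;
     rewrite !mxE /e /= ?linearZl_LR ?linearZ /= !wtab; lra.
have f4 x y : f (g x y) 0 4 = omega1 (f x) (f y).
  have linw k p q r :
      eta (g (k *: p + q) r) = idfun k * eta (g p r) + eta (g q r).
    by rewrite linearDl linearZl_LR linearD linearZ.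
  rewrite [LHS]mxE /= (alternating_expansion x y dim_g fe linw wC w0) /e /=.
  rewrite (wC a b) wba wac wad wbc wbd wcd !linearZr_LR !linearZ /=.
  by rewrite !(wC _ xi) !wxi /omega1; field.
pose z := eps [tuple a; b].
(* Since c = J b and d = J a, type (2,0) pulls every J out as a factor i, and all components become
   multiples of [z]. *)
have epsE x y : eps [tuple x; y]
    = ((omega2 (f x) (f y))%:C + 'i%C * (omega3 (f x) (f y))%:C) * z.
  have epsR p q : eta p = 0 -> eta q = 0 ->
      eps [tuple p; J q] = 'i%C * eps [tuple p; q].
    by move=> p0 q0; rewrite epsC epsJ // -mulrN -epsC.
  have epsx0 u : eps [tuple u; - 2 *: xi] = 0.
    have eps00 : eps [tuple 0; u] = 0.
      by rewrite -(subrr xi) -scaleN1r addrC epsl epsX mulr0 addr0.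
    by rewrite epsC -[_ *: xi]addr0 epsl epsX mulr0 add0r eps00 oppr0.
  rewrite (alternating_expansion (B := fun u v => eps [tuple u; v]) x y
    dim_g fe epsl epsC eps0).
  rewrite /e /= !epsx0 !epsR // !epsJ // (epsC b a) !eps0 -/z.
  have -> : (omega2 (f x) (f y))%:C
      = (minor 0 1 (f x) (f y))%:C + (minor 2 3 (f x) (f y))%:C.
    exact: rmorphD.
  have -> : (omega3 (f x) (f y))%:C
      = (minor 0 2 (f x) (f y))%:C - (minor 1 3 (f x) (f y))%:C.
    exact: rmorphB.
  by rewrite !mulrN ['i%C * ('i%C * _)]mulrA iC; ring.
have z0 : z != 0.
  by apply: contraNneq epsv => z0; rewrite [v]tuple2E epsE z0 mulr0.
have cl23 x y t :
    omega2 (f (g x y)) (f t) + omega2 (f (g y t)) (f x)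
      + omega2 (f (g t x)) (f y) = 0 /\
    omega3 (f (g x y)) (f t) + omega3 (f (g y t)) (f x)
      + omega3 (f (g t x)) (f y) = 0.
  (* After division by [z], the real and imaginary parts of closedness are the two cyclic
     identities. *)
  have /eqP := ce_closed2 cf cl x y t.
  rewrite !epsE -!mulrDl mulf_eq0 (negPf z0) orbF eq_complex /=.
  by move=> /andP[/eqP re /eqP im]; split; [rewrite -re|rewrite -im]; ring.
by apply: (heisenberg_of_frame (f := f) (e := e)) => // x y t;
  case: (cl23 x y t).
Qed.
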